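(* Let $M=M^*\in\mathbb{C}^{n\times n}$ be $\beta$-banded and positive definite and let $\mathcal{A}=M\otimes I+I\otimes M$. Let $f$ be a Cauchy--Stieltjes function, $f(x)=\int_{-\infty}^0\frac{\mathrm{d}\gamma(\omega)}{x-\omega}$ for $x\in\mathbb{C}\setminus(-\infty,0]$. Then for $k=(k_1,k_2)$ and $t=(t_1,t_2)$, $$|(f(\mathcal{A}))_{kt}|\le\int_0^\infty\left(|(\exp(-\tau M))_{k_1t_1}|\,|(\exp(-\tau M))_{k_2t_2}|\int_{-\infty}^0\exp(\tau\omega)\,\mathrm{d}\gamma(\omega)\right)\mathrm{d}\tau.$$
   Context: A matrix $M\in\mathbb{C}^{n\times n}$ is $\beta$-banded if $M_{ij}=0$ whenever $|i-j|>\beta$. $I$ is the $n\times n$ identity and $\otimes$ the Kronecker product. A lexicographic ordering is used, so that each row or column index $k\in\{1,\dots,n^2\}$ of $\mathcal{A}$ corresponds to the pair $k=(k_1,k_2)\in\{1,\dots,n\}^2$ with $k=(k_2-1)n+k_1$. Here a Cauchy--Stieltjes function is a function of the form $f(x)=\int_{-\infty}^0\frac{\mathrm{d}\gamma(\omega)}{x-\omega}$, $x\in\mathbb{C}\setminus(-\infty,0]$, where $\gamma$ is a (possibly signed) real measure on $(-\infty,0]$ and the integral is absolutely convergent. $f(\mathcal{A})$ is the usual matrix function of the Hermitian positive definite matrix $\mathcal{A}$.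
   Formalization: For signed γ the printed bound fails (n=1, M=1, γ=−δ_0: 1/2 ≤ −1/2), so it is proved for nonnegative γ; for every signed γ it is proved with the inner integral of exp(τω) dγ(ω) replaced by its absolute value. *)

(* Defs.v *)
From HB Require Import structures.
From mathcomp Require Import all_boot all_order all_algebra.
From mathcomp Require Export complex mxtens.
From mathcomp Require Import all_classical all_reals all_analysis.

Set Implicit Arguments.
Unset Strict Implicit.
Unset Printing Implicit Defensive.

Import Order.TTheory GRing.Theory Num.Theory.

Local Open Scope classical_set_scope.
Local Open Scope ring_scope.
Local Open Scope sesquilinear_scope.
Local Open Scope complex_scope.

Section MatrixFunction.
Variable C : numClosedFieldType.

(* g(A) = U^-1 g(D) U for a unitary diagonalization A = U^-1 D U of a normal
   matrix A; by funmx_diag the choice of U and D is immaterial. *)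
Definition funmx (g : C -> C) n (A : 'M[C]_n) : 'M[C]_n :=
  invmx (spectralmx A) *m diag_mx (map_mx g (spectral_diag A))
    *m spectralmx A.

Lemma funmx_diag (g : C -> C) n (A U : 'M[C]_n) (d : 'rV[C]_n) :
  U \is unitarymx -> A = invmx U *m diag_mx d *m U ->
  funmx g A = invmx U *m diag_mx (map_mx g d) *m U.
Proof.
move=> Uu AE.
have An : A \is normalmx by apply/orthomx_spectral_subproof; exists (U, d).
have /orthomx_spectralP := An; rewrite /funmx.
set P := spectralmx A; set s := spectral_diag A => AP.
have Pu : P \in unitmx := spectral_unit A.
have Uu' : U \in unitmx := unitarymx_unit Uu.
pose W := P *m invmx U.
have WE : diag_mx s *m W = W *m diag_mx d.
  have : P *m A *m invmx U = P *m A *m invmx U by [].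
  by rewrite {1}AP AE /W !mulmxA mulmxV // mul1mx mulmxK.
have WgE : diag_mx (map_mx g s) *m W = W *m diag_mx (map_mx g d).
  apply/matrixP => i j; move/matrixP: WE => /(_ i j).
  rewrite !mul_diag_mx !mul_mx_diag !mxE.
  set w := \sum_k _ => /eqP; rewrite mulrC -subr_eq0 -mulrBr mulf_eq0.
  case/orP=> [/eqP -> | ]; first by rewrite mulr0 mul0r.
  by rewrite subr_eq0 => /eqP ->; rewrite mulrC.
have PE : P = W *m U by rewrite /W mulmxKV.
rewrite {2}PE mulmxA -[_ *m _ *m W]mulmxA WgE /W !mulmxA mulVmx // mul1mx.
by [].
Qed.

End MatrixFunction.

Section Matrices.
Variable R : realType.

(* The modulus of a complex number, as a real number: the library norm on
   R[i] takes its values in R[i]. *)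
Definition modulus (z : R[i]) : R := complex.Re `|z|.

Definition cexp (z : R[i]) : R[i] :=
  let: a +i* b := z in (expR a * cos b) +i* (expR a * sin b).

Definition banded n (beta : nat) (M : 'M[R[i]]_n) : Prop :=
  forall i j : 'I_n, (beta < `|i%:Z - j%:Z|)%N -> M i j = 0.

(* The order of R[i] is partial: 0 < z also says that z is real. *)
Definition posdefmx n (M : 'M[R[i]]_n) : Prop :=
  M \is hermsymmx /\
  forall v : 'cV[R[i]]_n, v != 0 -> 0 < (v^t* *m M *m v) 0 0.

Definition expmx n (A : 'M[R[i]]_n) : 'M[R[i]]_n := funmx cexp A.

Definition kron_sum n (M : 'M[R[i]]_n) : 'M[R[i]]_(n * n) :=
  M *t 1%:M + 1%:M *t M.

(* With indices counted from 0, the pair k = (k1, k2) is the row k2 n + k1,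
   whereas mxtens_index (i, j) = i n + j. *)
Definition lex_index n (k : 'I_n * 'I_n) : 'I_(n * n) :=
  mxtens_index (k.2, k.1).

End Matrices.

Section CauchyStieltjes.
Variable R : realType.

(* A signed measure, given as a difference of two nonnegative measures. Both
   may have infinite mass, as for d(omega) / sqrt (- omega) on ]-oo, 0[, so
   that it need not be a (finite) charge. *)
Record signed_measure := SignedMeasure {
  pos_part : {measure set (measurableTypeR R) -> \bar R} ;
  neg_part : {measure set (measurableTypeR R) -> \bar R} }.

Implicit Type gamma : signed_measure.

Definition nonnegative_measure gamma : Prop :=
  forall A : set (measurableTypeR R), measurable A -> A `<=` `]-oo, 0] ->
    (neg_part gamma A <= pos_part gamma A)%E.

Definition abs_convergent gamma (g : R -> R[i]) : Prop :=
  (pos_part gamma).-integrable `]-oo, 0] (fun w => (modulus (g w))%:E) /\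
  (neg_part gamma).-integrable `]-oo, 0] (fun w => (modulus (g w))%:E).

Definition signed_Rint gamma (g : R -> R) : R :=
  \int[pos_part gamma]_(w in `]-oo, 0]) g w
  - \int[neg_part gamma]_(w in `]-oo, 0]) g w.

Definition signed_Cint gamma (g : R -> R[i]) : R[i] :=
  signed_Rint gamma (fun w => complex.Re (g w))
  +i* signed_Rint gamma (fun w => complex.Im (g w)).

(* In R[i], x <= 0 says that x is real and nonpositive. *)
Definition cauchy_stieltjes gamma (f : R[i] -> R[i]) : Prop :=
  forall x : R[i], ~~ (x <= 0) ->
    abs_convergent gamma (fun w => (x - w%:C)^-1) /\
    f x = signed_Cint gamma (fun w => (x - w%:C)^-1).

(* The integral of exp(tau w) d(gamma)(w). It is finite for tau > 0 under
   cauchy_stieltjes, but may be infinite at tau = 0. *)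
Definition laplace gamma (tau : R) : \bar R :=
  (\int[pos_part gamma]_(w in `]-oo, 0%R]) (expR (tau * w))%:E
   - \int[neg_part gamma]_(w in `]-oo, 0%R]) (expR (tau * w))%:E)%E.

End CauchyStieltjes.

(* Main.v *)
Require Import Defs.
From HB Require Import structures.
From mathcomp Require Import all_boot all_order all_algebra.
From mathcomp Require Import all_classical all_reals all_analysis.
From mathcomp Require Import measurable_realfun.

(* For each eigenvalue x > 0 of M (x) I + I (x) M, Tonelli's theorem applied to
   1 / (x - omega) = int_0^oo exp(- tau x) exp(tau omega) d(tau) turns the
   Cauchy-Stieltjes integral into
   f(x) = int_0^oo exp(- tau x) L(tau) d(tau), with L the Laplace transform of
   gamma. In a unitary eigenbasis this gives
   f(A)_kt = int_0^oo exp(- tau M)_(k1 t1) exp(- tau M)_(k2 t2) L(tau) d(tau),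
   because exp(- tau (M (x) I + I (x) M)) = exp(- tau M) (x) exp(- tau M). *)

Set Implicit Arguments.
Unset Strict Implicit.
Unset Printing Implicit Defensive.

Import Order.TTheory GRing.Theory Num.Theory.
Import numFieldNormedType.Exports.

Local Open Scope classical_set_scope.
Local Open Scope ring_scope.
Local Open Scope complex_scope.

(** * Unitary diagonalization of the Kronecker sum and entries of its matrix functions *)

Section SpectralDecomposition.
Local Open Scope sesquilinear_scope.

Lemma tensmx_unitary (C : numClosedFieldType) m n (U : 'M[C]_m) (V : 'M[C]_n) :
  U \is unitarymx -> V \is unitarymx -> U *t V \is unitarymx.
Proof.
move=> /unitarymxP UU /unitarymxP VV; apply/unitarymxP.
rewrite trmx_tens map_mxT tensmx_mul UU VV.
apply/matrixP => i j.
case: (mxtens_indexP i) => i1 i2; case: (mxtens_indexP j) => j1 j2.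
rewrite tensmxE !mxE (can_eq (@mxtens_indexK _ _)) xpair_eqE.
by case: eqP => _; rewrite ?mul0r ?mul1r.
Qed.

(** The quadratic form of [M] at the [i]-th unit eigenvector equals the [i]-th eigenvalue;
    positivity in [R[i]] makes that value real as well as positive. *)
Lemma posdefmx_spectral (R : realType) n (M : 'M[R[i]]_n) : posdefmx M ->
  exists U : 'M[R[i]]_n, exists l : 'rV[R]_n,
  [/\ U \is unitarymx, forall i, 0 < l 0 i &
      M = invmx U *m diag_mx (map_mx (real_complex R) l) *m U].
Proof.
move=> [Mh Mpos].
have /hermitian_normalmx /orthomx_spectralP ME := Mh.
set U := spectralmx M in ME; set s := spectral_diag M in ME.
have Uu : U \is unitarymx by exact: spectral_unitarymx.
clearbody U s; have Uunit := unitarymx_unit Uu.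
have s_gt0 i : 0 < s 0 i.
  (* Column [i] of [invmx U], an eigenvector for [s 0 i]. *)
  pose v : 'cV_n := invmx U *m delta_mx i 0.
  have Uv : U *m v = delta_mx i 0 by rewrite /v mulKVmx.
  have v0 : v != 0.
    apply: contraTneq isT => v0; move: Uv; rewrite v0 mulmx0.
    move=> /matrixP /(_ i 0); rewrite !mxE !eqxx => /esym /eqP.
    by rewrite oner_eq0.
  have := Mpos v v0; rewrite {1}ME.
  have -> : v^t* = (delta_mx i 0)^T *m U.
    rewrite /v trmx_mul map_mxM invmx_unitary // map_trmx trmxK.
    rewrite -map_mx_comp.
    congr (_ *m _); last by apply/matrixP => a b; rewrite !mxE /= conjCK.
    by apply/matrixP => a b; rewrite !mxE rmorph_nat.
  rewrite -!mulmxA Uv [U *m _]mulmxA mulmxV // mul1mx mul_diag_mx trmx_delta.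
  rewrite -rowE !mxE.
  by rewrite !eqxx mulr1.
exists U, (\row_i complex.Re (s 0 i)); split.
- exact: Uu.
- move=> i; rewrite mxE; have := s_gt0 i.
  by case: (s 0 i) => a b; rewrite ltcE => /andP[].
- rewrite {1}ME; congr (_ *m diag_mx _ *m _); apply/matrixP => a i.
  rewrite !mxE (ord1 a); have := s_gt0 i; case: (s 0 i) => x y /=.
  by rewrite ltcE /= => /andP[/eqP -> _].
Qed.

(** By the mixed product rule, [U *t U] diagonalizes both Kronecker terms at once, so the
    eigenvalues add in pairs. *)
Lemma kron_sum_spectral (R : realType) n (M U : 'M[R[i]]_n) (d : 'rV[R[i]]_n) :
  U \is unitarymx -> M = invmx U *m diag_mx d *m U ->
  kron_sum M = invmx (U *t U)
    *m diag_mx (\row_p (d 0 (mxtens_unindex p).1 + d 0 (mxtens_unindex p).2))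
    *m (U *t U).
Proof.
move=> Uu ME; rewrite invmx_unitary; last exact: tensmx_unitary.
have -> : diag_mx (\row_p (d 0 (mxtens_unindex p).1 + d 0 (mxtens_unindex p).2))
    = diag_mx d *t 1%:M + 1%:M *t diag_mx d.
  apply/matrixP => i j.
  case: (mxtens_indexP i) => i1 i2; case: (mxtens_indexP j) => j1 j2.
  rewrite [RHS]mxE !tensmxE !mxE !mxtens_indexK /=.
  rewrite (can_eq (@mxtens_indexK _ _)) xpair_eqE.
  case: eqP => [->|_]; case: eqP => [->|_];
    by rewrite /= ?(mulr1n, mulr0n, mul0r, mulr0, mul1r, mulr1, addr0).
rewrite trmx_tens map_mxT mulmxDr mulmxDl !tensmx_mul -invmx_unitary //.
by rewrite -ME !mulmx1 mulVmx // unitarymx_unit.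
Qed.

(** The coefficients do not depend on [g], so an integral representation of [g] passes to the
    entries through a finite sum. *)
Lemma funmx_spectralE (C : numClosedFieldType) (g : C -> C) n (A U : 'M[C]_n)
    (d : 'rV[C]_n) i j :
  U \is unitarymx -> A = invmx U *m diag_mx d *m U ->
  funmx g A i j = \sum_p invmx U i p * U p j * g (d 0 p).
Proof.
move=> Uu AE; rewrite (funmx_diag g Uu AE) mxE.
by apply: eq_bigr => p _; rewrite mul_mx_diag !mxE mulrAC.
Qed.

Lemma expmx_spectralE (R : realType) n (M U : 'M[R[i]]_n) (l : 'rV[R]_n)
    (tau : R) i j :
  U \is unitarymx -> M = invmx U *m diag_mx (map_mx (real_complex R) l) *m U ->
  expmx ((- tau)%:C *: M) i j =
  \sum_p invmx U i p * U p j * (expR (- tau * l 0 p))%:C.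
Proof.
move=> Uu ME.
have tauME : (- tau)%:C *: M =
    invmx U *m diag_mx (map_mx (real_complex R) (- tau *: l)) *m U.
  have -> : diag_mx (map_mx (real_complex R) (- tau *: l))
      = (- tau)%:C *: diag_mx (map_mx (real_complex R) l).
    by apply/matrixP => a b; rewrite !mxE rmorphM mulrnAr.
  by rewrite -scalemxAr -scalemxAl -ME.
rewrite /expmx (funmx_spectralE _ _ _ Uu tauME).
apply: eq_bigr => p _; congr (_ * _); rewrite !mxE /=.
by rewrite cos0 sin0 mulr1 mulr0.
Qed.

(** The same [c] and [l] serve [f] and the exponentials: entries of [U *t U] factor over pairs of
    eigenvalues of [M], and the two exponentials multiply to the exponential of the sum. *)
Lemma funmx_kron_sumE (R : realType) n (M : 'M[R[i]]_n) (k1 k2 t1 t2 : 'I_n) :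
  posdefmx M -> exists c : 'I_(n * n) -> R[i], exists l : 'I_(n * n) -> R,
  [/\ forall p, 0 < l p,
      forall f, funmx f (kron_sum M) (lex_index (k1, k2)) (lex_index (t1, t2))
        = \sum_p c p * f (l p)%:C &
      forall tau, expmx ((- tau)%:C *: M) k1 t1 * expmx ((- tau)%:C *: M) k2 t2
        = \sum_p c p * (expR (- (l p * tau)))%:C].
Proof.
move=> /posdefmx_spectral[U [l [Uu l_gt0 ME]]].
have UUu := tensmx_unitary Uu Uu.
exists (fun p => invmx (U *t U) (lex_index (k1, k2)) p
                 * (U *t U) p (lex_index (t1, t2))).
exists (fun p => l 0 (mxtens_unindex p).1 + l 0 (mxtens_unindex p).2).
split=> [p|f|tau]; first exact: addr_gt0.
  rewrite (funmx_spectralE f _ _ UUu (kron_sum_spectral Uu ME)).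
  by apply: eq_bigr => p _; rewrite !mxE rmorphD.
(* The factors are swapped because [lex_index] puts the second component first in the tensor
   index. *)
rewrite !(expmx_spectralE _ _ _ Uu ME) mulrC mulr_sum.
apply: eq_bigr => p _; case: (mxtens_indexP p) => p1 p2.
rewrite /lex_index !mxtens_indexK /= [invmx (U *t U)]invmx_unitary //.
rewrite trmx_tens map_mxT -invmx_unitary // !tensmxE mulrACA.
rewrite [X in X * _]mulrACA.
congr (_ * _); rewrite -rmorphM -expRD; congr (expR _)%:C.
by rewrite !mulNr -opprD mulrDl ![tau * _]mulrC.
Qed.

End SpectralDecomposition.

(** * The exponential integral and sigma-finiteness *)

Lemma integral_expRN (R : realType) (a : R) : 0 < a ->
  (\int[lebesgue_measure]_(t in `[0%R, +oo[) (expR (- (a * t)))%:E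
   = (a^-1)%:E)%E.
Proof.
move=> a0.
(* The exponential density of rate [a] has total mass 1. *)
have : (\int[lebesgue_measure]_(t in `[0%R, +oo[) (a * expR (- (a * t)))%:E
   = 1)%E.
  rewrite -(integral_exponential_pdf a0) integral_mkcond restrict_EFin.
  apply: eq_integral => x _; rewrite /exponential_pdf /= /patch.
  by case: ifP; rewrite ?mulNr.
under eq_integral do rewrite EFinM.
rewrite ge0_integralZl_EFin //; last 2 first.
- apply/measurable_EFinP/measurable_funTS; apply: measurableT_comp => //.
  exact: measurableT_comp.
- exact: ltW.
move=> H; rewrite -[LHS]mul1e -[1%E]/(1%:E) -(mulVf (lt0r_neq0 a0)) EFinM.
by rewrite -muleA H mule1.
Qed.

(** The level sets where [g] is at least [1 / (k + 1)] exhaust [D] since [g] is positive, and each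
    has finite measure by Markov's inequality. The complement of [D] is null for the restricted
    measure. *)
Lemma sigma_finite_mrestr d (T : measurableType d) (R : realType)
    (mu : {measure set T -> \bar R}) (D : set T) (mD : measurable D)
    (g : T -> R) :
  mu.-integrable D (EFin \o g) -> (forall x, D x -> 0 < g x) ->
  sigma_finite setT (mrestr mu mD).
Proof.
move=> /integrableP[mg ig] g0.
pose E k := D `&` [set x | ((k.+1%:R^-1 : R)%:E <= `|(EFin \o g) x|)%E].
have mE k : measurable (E k).
  by apply: emeasurable_fun_c_infty => //; exact: measurableT_comp.
exists (fun k => ~` D `|` E k).
  apply/esym; rewrite -subTset => x _.
  have [Dx|nDx] := pselect (D x); last by exists 0%N => //; left.
  have [k kg] : exists k, k.+1%:R^-1 < g x.
    have [k /= _] := near_infty_natSinv_lt (PosNum (g0 _ Dx)).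
    by move=> /(_ k (leqnn k)) ?; exists k.
  exists k => //; right; split=> //=.
  by rewrite lee_fin (le_trans (ltW kg)) // ler_norm.
move=> k; split; first by apply: measurableU => //; exact: measurableC.
rewrite /mrestr setIUl setICl set0U.
have -> : E k `&` D = E k by rewrite /E setIAC setIid.
have k0 : (0 < k.+1%:R^-1 :> R) by rewrite invr_gt0.
have := le_lt_trans (le_integral_abse mu mD mg k0) ig.
rewrite -/(E k); have := measure_ge0 mu (E k).
by case: (mu (E k)) => [r| |] //; rewrite ?ltry // gt0_muley ?lte_fin.
Qed.

(* Tonelli's theorem needs a sigma-finite measure, and the parts of gamma are
   unconstrained outside ]-oo, 0]. *)
Lemma sigma_finite_measure_restr d (T : measurableType d) (R : realType)
    (mu : {measure set T -> \bar R}) (D : set T) (g : T -> R) :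
  measurable D ->
  mu.-integrable D (EFin \o g) -> (forall x, D x -> 0 < g x) ->
  exists m : {sigma_finite_measure set T -> \bar R},
    forall A, measurable A -> A `<=` D -> mu A = m A.
Proof.
move=> mD ig g0; have sf := sigma_finite_mrestr mD ig g0.
pose m0 : {measure set T -> \bar R} := mrestr mu mD.
pose H1 := isSFinite.Build _ _ _ _ (@sfinite_measure_sigma_finite _ _ _ m0 sf).
pose H2 := isSigmaFinite.Build _ _ _ (Measure.sort m0) sf.
pose m := HB.pack_for {sigma_finite_measure set T -> \bar R}
  (Measure.sort m0) H1 H2.
by exists m => A mA AD; rewrite /m /= /mrestr setIidl.
Qed.

(** * The Laplace transform of a nonnegative measure by Tonelli's theorem *)

Section Laplace.
Local Open Scope ereal_scope.
Context (R : realType).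

(** Tonelli's theorem is applied on the full product space, so both domains of integration enter as
    indicator factors. *)
Let kern (l : R) (z : measurableTypeR R * measurableTypeR R) : R :=
  (expR (- (l * z.1)) * \1_`[0%R, +oo[ z.1
   * (expR (z.1 * z.2) * \1_`]-oo, 0%R] z.2))%R.

Let kern_ge0 l z : (0 <= kern l z)%R.
Proof. by rewrite /kern !mulr_ge0 ?expR_ge0 // indicE ler0n. Qed.

Let measurable_kern l : measurable_fun setT (EFin \o kern l).
Proof.
apply/measurable_EFinP; apply: measurable_funM; apply: measurable_funM.
- apply: measurableT_comp => //; apply: measurableT_comp => //.
  exact: measurable_funM.
- by apply: measurableT_comp => //; exact: measurable_indic.
- by apply: measurableT_comp => //; exact: measurable_funM.
- by apply: measurableT_comp => //; exact: measurable_indic.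
Qed.

Lemma measurable_laplace_integral
    (mu : {sigma_finite_measure set (measurableTypeR R) -> \bar R}) :
  measurable_fun (`[0%R, +oo[ : set (measurableTypeR R))
    (fun t => \int[mu]_(w in `]-oo, 0%R]) (expR (t * w))%:E).
Proof.
(* For [l = 0] the first exponential is 1, and the partial integral of the kernel is the Laplace
   integral. *)
have mF := measurable_fun_fubini_tonelli_F (m2 := mu) _ (measurable_kern 0)
  (fun z => kern_ge0 0 z).
apply: eq_measurable_fun (measurable_funTS mF) => t.
rewrite inE /= => t0; rewrite /fubini_F [RHS]integral_mkcond restrict_EFin.
apply: eq_integral => w _; rewrite /kern /= mul0r oppr0 expR0 mul1r.
rewrite !indicE mem_set // mul1r /patch /=.
by case: ifP; rewrite ?(mulr1, mulr0).
Qed.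

(** After the exchange, the inner integral over [t] is that of [exp (- (l - w) t)], equal to
    [1 / (l - w)] because [w <= 0 < l]. *)
Lemma laplace_tonelli
    (mu : {sigma_finite_measure set (measurableTypeR R) -> \bar R}) (l : R) :
  (0 < l)%R ->
  \int[lebesgue_measure]_(t in `[0%R, +oo[)
     ((expR (- (l * t)))%:E * \int[mu]_(w in `]-oo, 0%R]) (expR (t * w))%:E)
  = \int[mu]_(w in `]-oo, 0%R]) ((l - w)^-1)%:E.
Proof.
move=> l0.
have D0 : measurable (`]-oo, 0%R] : set (measurableTypeR R)) by [].
transitivity (\int[lebesgue_measure]_t \int[mu]_w (EFin \o kern l) (t, w)).
  rewrite integral_mkcond; apply: eq_integral => t _; rewrite /patch.
  case: ifP => t0; last first.
    apply/esym/integral0_eq => w _.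
    by rewrite /kern /= !indicE t0 mulr0 mul0r.
  rewrite -ge0_integralZl_EFin ?expR_ge0 //; last first.
    apply/measurable_EFinP/measurable_funTS; exact: measurableT_comp.
  rewrite integral_mkcond; apply: eq_integral => w _.
  rewrite /kern /patch /= !indicE t0 mulr1.
  by case: ifP; rewrite ?(mulr1, mulr0).
rewrite (fubini_tonelli (m2 := mu) _ (measurable_kern l)
  (fun z => kern_ge0 l z)).
apply/esym; rewrite integral_mkcond; apply: eq_integral => w _; rewrite /patch.
case: ifP => w0; last first.
  apply/esym/integral0_eq => t _.
  by rewrite /kern /= !indicE w0 !mulr0.
have lw : (0 < l - w)%R.
  move: w0; rewrite inE /= in_itv /= => w0.
  by rewrite subr_gt0 (le_lt_trans w0).
rewrite -integral_expRN // integral_mkcond; apply: eq_integral => t _.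
rewrite /kern /patch /= !indicE w0 mulr1.
case: ifP; rewrite ?(mulr1, mulr0, mul0r) // => _.
by rewrite -expRD mulrBl opprB addrC [(w * t)%R]mulrC.
Qed.

End Laplace.

(** * The complex modulus and complex combinations of real numbers *)

Lemma modulus_real (R : realType) (x : R) : 0 <= x -> modulus x%:C = x.
Proof. by move=> x0; rewrite /modulus ger0_norm // lecR. Qed.

Lemma modulusM (R : realType) (y z : R[i]) :
  modulus (y * z) = modulus y * modulus z.
Proof. by rewrite /modulus normrM !normc_def /= mulr0 subr0. Qed.

Lemma modulusE (R : realType) (z : R[i]) : (modulus z)%:C = `|z|.
Proof. by rewrite /modulus normc_def. Qed.

Lemma ler_Re_modulus (R : realType) (z : R[i]) : `|complex.Re z| <= modulus z.
Proof. by rewrite -lecR modulusE; exact: normc_ge_Re. Qed.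

Lemma Re_sum_real (R : realType) (I : finType) (c : I -> R[i]) (r : I -> R) :
  complex.Re (\sum_p c p * (r p)%:C) = \sum_p complex.Re (c p) * r p.
Proof.
rewrite raddf_sum; apply: eq_bigr => p _.
by case: (c p) => a b /=; rewrite mulr0 subr0.
Qed.

Lemma Im_sum_real (R : realType) (I : finType) (c : I -> R[i]) (r : I -> R) :
  complex.Im (\sum_p c p * (r p)%:C) = \sum_p complex.Im (c p) * r p.
Proof.
rewrite raddf_sum; apply: eq_bigr => p _.
by case: (c p) => a b /=; rewrite mulr0 add0r.
Qed.

(** The modulus is the square root of the sum of the squared real and imaginary parts, each a real
    linear combination of the [g p]. *)
Lemma measurable_modulus_sum (R : realType) (I : finType) (c : I -> R[i])
    (g : I -> measurableTypeR R -> R) :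
  (forall p, measurable_fun setT (g p)) ->
  measurable_fun setT (fun t => modulus (\sum_p c p * (g p t)%:C)).
Proof.
move=> mg; rewrite /modulus.
under eq_fun => t do rewrite normc_def Re_sum_real Im_sum_real /=.
apply: measurableT_comp.
  by apply: continuous_measurable_fun; exact: sqrt_continuous.
by apply: measurable_funD; apply: measurable_funX; apply: measurable_sum => p;
  exact: measurable_funM.
Qed.

(** The case of one nonnegative measure. Tonelli's theorem gives a finite integral, hence almost
    everywhere a finite transform, which may then be replaced by its real value. *)
Lemma stieltjes_laplace (R : realType)
    (mu : {measure set (measurableTypeR R) -> \bar R}) :
  (forall l : R, 0 < l ->
    mu.-integrable `]-oo, 0] (fun w => ((l - w)^-1)%:E)) ->
  let L t := (\int[mu]_(w in `]-oo, 0%R]) (expR (t * w))%:E)%E in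
  [/\ measurable_fun (`[0%R, +oo[ : set (measurableTypeR R)) L,
      {ae lebesgue_measure, forall t : R,
        `[0, +oo[%classic t -> L t \is a fin_num} &
      forall l : R, 0 < l ->
        lebesgue_measure.-integrable `[0, +oo[
          (EFin \o (fun t => expR (- (l * t)) * fine (L t))) /\
        \int[lebesgue_measure]_(t in `[0, +oo[) (expR (- (l * t)) * fine (L t))
        = \int[mu]_(w in `]-oo, 0]) (l - w)^-1].
Proof.
move=> mu_int L.
have mD : measurable (`]-oo, 0%R] : set (measurableTypeR R)) by [].
have mT : measurable (`[0%R, +oo[ : set (measurableTypeR R)) by [].
(* The positive integrable function [1 / (1 - w)] witnesses sigma-finiteness; the value 1 is an
   arbitrary positive choice. *)
have [x|m mE] := sigma_finite_measure_restr mD (mu_int 1 ltr01).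
  by rewrite /= in_itv /= => x0; rewrite invr_gt0 subr_gt0 (le_lt_trans x0).
have LE : L = fun t => (\int[m]_(w in `]-oo, 0%R]) (expR (t * w))%:E)%E.
  by apply/funext => t; exact: eq_measure_integral.
have mL : measurable_fun (`[0%R, +oo[ : set (measurableTypeR R)) L.
  by rewrite LE; exact: measurable_laplace_integral.
have L0 t : (0 <= L t)%E.
  by apply: integral_ge0 => w _; rewrite lee_fin expR_ge0.
pose I (l t : R) := ((expR (- (l * t)))%:E * L t)%E.
have I0 l t : (0 <= I l t)%E by rewrite mule_ge0 // lee_fin expR_ge0.
have mI l : measurable_fun (`[0%R, +oo[ : set (measurableTypeR R)) (I l).
  apply: emeasurable_funM => //; apply/measurable_EFinP/measurable_funTS.
  by apply: measurableT_comp => //; exact: measurableT_comp.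
have intI l : 0 < l -> (\int[lebesgue_measure]_(t in `[0%R, +oo[) I l t
    = \int[mu]_(w in `]-oo, 0%R]) ((l - w)^-1)%:E)%E.
  move=> l0; rewrite /I LE laplace_tonelli //; apply/esym.
  exact: eq_measure_integral.
have intgI l : 0 < l -> lebesgue_measure.-integrable `[0, +oo[ (I l).
  move=> l0; apply/integrableP; split=> //.
  under eq_integral do rewrite gee0_abs //.
  rewrite intI // -(gee0_abs (integral_ge0 _ _)); last first.
    move=> w; rewrite /= in_itv /= => w0.
    by rewrite lee_fin invr_ge0 subr_ge0 (le_trans w0) // ltW.
  have /integrableP[mg] := mu_int _ l0.
  by apply: le_lt_trans; exact: le_abse_integral.
(* The exponential factor is positive, so an infinite [L t] would make [I 1 t] infinite;
   integrability at the single value 1 suffices. *)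
have Lfin : {ae lebesgue_measure, forall t : R,
    `[0, +oo[%classic t -> L t \is a fin_num}.
  apply: filterS (integrable_ae mT (intgI _ ltr01)) => t /= It t0.
  have := It t0; have := L0 t; rewrite /I.
  by case: (L t) => [r| |] // _; rewrite gt0_muley ?lte_fin ?expR_gt0.
split=> // l l0.
have IE : {ae lebesgue_measure, forall t : R, `[0, +oo[%classic t ->
    I l t = (EFin \o (fun t => expR (- (l * t)) * fine (L t))) t}.
  apply: (@filterS _ _ (ae_filter_ringOfSetsType lebesgue_measure) _ _ _ Lfin).
  by move=> t /= Lt t0; rewrite EFinM fineK ?Lt.
have mfI : measurable_fun (`[0, +oo[ : set (measurableTypeR R))
    (EFin \o (fun t => expR (- (l * t)) * fine (L t))).
  apply/measurable_EFinP; apply: measurable_funM.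
    apply/measurable_funTS.
    by apply: measurableT_comp => //; exact: measurableT_comp.
  exact: measurableT_comp.
split.
  (* As [fine] sends infinite values to 0, the domination holds at every [t]. *)
  apply: le_integrable (intgI _ l0) => // t _.
  rewrite /I /= normrM EFinM abseM lee_wpmul2l //.
  by case: (L t) => [r| |] /=; rewrite ?leey ?lexx.
congr fine; rewrite -intI //; apply/esym.
exact: ae_eq_integral.
Qed.

(** * Cauchy-Stieltjes functions of a signed measure on the positive axis *)

Section CauchyStieltjes.
Variables (R : realType) (gamma : signed_measure R) (f : R[i] -> R[i]).
Hypothesis hf : cauchy_stieltjes gamma f.

(** At a real [l > 0] the integrand is real and positive: it equals its modulus, and the imaginary
    part of the integral vanishes. *)
Lemma cauchy_stieltjes_real (l : R) : 0 < l ->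
  [/\ (pos_part gamma).-integrable `]-oo, 0] (fun w => ((l - w)^-1)%:E),
      (neg_part gamma).-integrable `]-oo, 0] (fun w => ((l - w)^-1)%:E) &
      f l%:C = (signed_Rint gamma (fun w => (l - w)^-1))%:C].
Proof.
move=> l0; have lC : ~~ (l%:C <= 0) by rewrite lecR -ltNge.
have [[pint nint] ->] := hf lC.
have E w : (l%:C - w%:C)^-1 = ((l - w)^-1)%:C by rewrite fmorphV rmorphB.
have modE : {in `]-oo, 0]%classic,
    (fun w => (modulus (l%:C - w%:C)^-1)%:E) =1 (fun w => ((l - w)^-1)%:E)}.
  move=> w; rewrite inE /= in_itv /= => w0; rewrite E modulus_real //.
  by rewrite invr_ge0 subr_ge0 (le_trans w0) // ltW.
split.
- by move: pint; apply: eq_integrable.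
- by move: nint; apply: eq_integrable.
rewrite /signed_Cint /signed_Rint; congr (_ +i* _).
  by congr (_ - _); apply: eq_Rintegral => w _; rewrite E.
have im0 (mu : {measure set (measurableTypeR R) -> \bar R}) :
    \int[mu]_(w in `]-oo, 0]) complex.Im ((l%:C - w%:C)^-1) = 0.
  rewrite /Rintegral integral0_eq // => w _.
  by rewrite E.
by rewrite !im0 subr0.
Qed.

(** Subtracts the representations of the two parts. The real-valued [l] stands in for
    [laplace gamma], whose value may be infinite on a null set. *)
Lemma cauchy_stieltjes_laplace : exists l : R -> R,
  [/\ measurable_fun (`[0%R, +oo[ : set (measurableTypeR R)) (laplace gamma),
      {ae lebesgue_measure, forall t : R, `[0, +oo[%classic t ->
        laplace gamma t = (l t)%:E},
      nonnegative_measure gamma -> {ae lebesgue_measure, forall t : R,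
        `[0, +oo[%classic t -> `|laplace gamma t|%E = laplace gamma t} &
      forall x : R, 0 < x ->
        lebesgue_measure.-integrable `[0, +oo[
          (EFin \o (fun t => expR (- (x * t)) * l t)) /\
        f x%:C
        = (\int[lebesgue_measure]_(t in `[0, +oo[)
             (expR (- (x * t)) * l t))%:C].
Proof.
have pint x (x0 : 0 < x) := let: And3 h _ _ := cauchy_stieltjes_real x0 in h.
have nint x (x0 : 0 < x) := let: And3 _ h _ := cauchy_stieltjes_real x0 in h.
have [/= mp fp ip] := stieltjes_laplace pint.
have [/= mn fn in_] := stieltjes_laplace nint.
have F : Filter (almost_everywhere (@lebesgue_measure R)).
  exact: (ae_filter_ringOfSetsType lebesgue_measure).
pose Lp t := (\int[pos_part gamma]_(w in `]-oo, 0%R]) (expR (t * w))%:E)%E.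
pose Ln t := (\int[neg_part gamma]_(w in `]-oo, 0%R]) (expR (t * w))%:E)%E.
exists (fun t => fine (Lp t) - fine (Ln t)); split.
- exact: emeasurable_funB.
- apply: (@filterS2 _ _ F _ _ _ _ fp fn) => t /= Lpt Lnt t0.
  by rewrite EFinB !fineK; [|exact: Lnt|exact: Lpt].
- move=> gamma0; apply: (@filterS2 _ _ F _ _ _ _ fp fn) => t /= Lpt Lnt t0.
  (* Finiteness of the positive part excludes [+oo - +oo], which evaluates to [-oo]; it remains to
     compare the two integrals. *)
  rewrite gee0_abs // sube_ge0; last by rewrite [X in _ || X]Lpt // orbT.
  have mD : measurable (`]-oo, 0%R] : set (measurableTypeR R)) by [].
  rewrite /Lp /Ln.
  (* The comparison of the two parts is known only inside the half-line, whereas monotonicity in the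
     measure asks for it on all measurable sets; restricting both measures bridges this. *)
  have restrE (mu : {measure set (measurableTypeR R) -> \bar R}) :
      (\int[mu]_(w in `]-oo, 0%R]) (expR (t * w))%:E
       = \int[mrestr mu mD]_(w in `]-oo, 0%R]) (expR (t * w))%:E)%E.
    by apply: eq_measure_integral => A mA AD; rewrite /= /mrestr setIidl.
  rewrite (restrE (neg_part gamma)) (restrE (pos_part gamma)).
  apply: ge0_le_measure_integral => //.
  + move=> S mS; apply: gamma0; first exact: measurableI.
    exact: subIsetr.
  + by apply/measurable_EFinP; apply: measurableT_comp => //;
      exact: measurableT_comp.
move=> x x0; have [_ _ ->] := cauchy_stieltjes_real x0.
have [ipx pE] := ip _ x0; have [inx nE] := in_ _ x0.
under [X in _.-integrable _ X /\ _]eq_fun do rewrite mulrBr EFinB.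
split; first exact: integrableB.
under eq_Rintegral do rewrite mulrBr.
by rewrite RintegralB // pE nE.
Qed.

End CauchyStieltjes.

(** For a signed [gamma] the Laplace transform may be negative, hence the absolute value in the
    first bound; nonnegativity of [gamma] removes it. *)
Theorem mainTheorem8 (R : realType) (n beta : nat) (M : 'M[R[i]]_n)
    (hband : banded beta M) (hM : posdefmx M)
    (gamma : signed_measure R) (f : R[i] -> R[i])
    (hf : cauchy_stieltjes gamma f) (k1 k2 t1 t2 : 'I_n) :
  let fA := funmx f (kron_sum M) (lex_index (k1, k2)) (lex_index (t1, t2)) in
  let w := fun tau : R =>
    modulus (expmx ((- tau)%:C *: M) k1 t1)
    * modulus (expmx ((- tau)%:C *: M) k2 t2) in
  ((modulus fA)%:E <=
     \int[lebesgue_measure]_(tau in `[0%R, +oo[)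
       ((w tau)%:E * `|laplace gamma tau|))%E
  /\ (nonnegative_measure gamma ->
      ((modulus fA)%:E <=
         \int[lebesgue_measure]_(tau in `[0%R, +oo[)
           ((w tau)%:E * laplace gamma tau))%E).
Proof.
move=> fA w.
have [c [l [l_gt0 fE expE]]] := funmx_kron_sumE k1 k2 t1 t2 hM.
have [h [mL Lh L0 hint]] := cauchy_stieltjes_laplace hf.
have mT : measurable (`[0%R, +oo[ : set (measurableTypeR R)) by [].
have F : Filter (almost_everywhere (@lebesgue_measure R)).
  exact: (ae_filter_ringOfSetsType lebesgue_measure).
have wE t : w t = modulus (\sum_p c p * (expR (- (l p * t)))%:C).
  by rewrite /w -modulusM expE.
have mw : measurable_fun (`[0%R, +oo[ : set (measurableTypeR R)) w.
  rewrite (funext wE); apply: measurable_funTS.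
  apply: measurable_modulus_sum => p.
  by apply: measurableT_comp => //; exact: measurableT_comp.
have w0 t : 0 <= w t by rewrite wE -lecR modulusE normr_ge0.
have mwL : measurable_fun (`[0%R, +oo[ : set (measurableTypeR R))
    (fun t => ((w t)%:E * laplace gamma t)%E).
  by apply: emeasurable_funM => //; exact/measurable_EFinP.
have mwaL : measurable_fun (`[0%R, +oo[ : set (measurableTypeR R))
    (fun t => ((w t)%:E * `|laplace gamma t|)%E).
  apply: emeasurable_funM; first exact/measurable_EFinP.
  exact: measurableT_comp.
have bound : ((modulus fA)%:E <= \int[lebesgue_measure]_(tau in `[0%R, +oo[)
    ((w tau)%:E * `|laplace gamma tau|))%E.
  (* A zero entry has no phase to rotate by; there the bound is nonnegativity of the integral. *)
  have [fA0|fA0] := eqVneq fA 0.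
    rewrite fA0 -[0]/(0%:C) modulus_real //.
    by apply: integral_ge0 => t _; rewrite mule_ge0 ?lee_fin.
  (* Rotating fA to the positive axis replaces the complex integral by a real
     one. *)
  pose u := `|fA| / fA.
  have modu : modulus u = 1.
    apply: complexI; rewrite modulusE /u normrM normr_id normfV divff //.
    by rewrite normr_eq0.
  (* The share of the eigenvalue [l p] in the real part of the rotated integrand, with the
     real-valued [h] in place of the transform. *)
  pose g p t := complex.Re (u * c p) * (expR (- (l p * t)) * h t).
  have gint p : lebesgue_measure.-integrable `[0, +oo[ (EFin \o g p).
    have [hp _] := hint _ (l_gt0 p).
    by rewrite /g; apply: (integrableZl mT (complex.Re (u * c p)) hp).
  have gsint : lebesgue_measure.-integrable `[0, +oo[
      (fun t => \sum_p (g p t)%:E)%E.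
    exact: (@integrable_sum _ _ _ _ _ mT _ _ _ (fun p => EFin \o g p)).
  have fAE : ((modulus fA)%:E =
      \int[lebesgue_measure]_(t in `[0%R, +oo[) (\sum_p (g p t)%:E))%E.
    rewrite (@integral_sum _ _ _ _ _ mT _ (fun p => EFin \o g p) gint).
    have -> : modulus fA = complex.Re (u * fA) by rewrite /modulus /u divfK.
    rewrite /fA fE mulr_sumr.
    have -> : \sum_p u * (c p * f (l p)%:C) = \sum_p u * c p *
        (\int[lebesgue_measure]_(t in `[0, +oo[) (expR (- (l p * t)) * h t))%:C.
      by apply: eq_bigr => p _; rewrite mulrA; have [_ ->] := hint _ (l_gt0 p).
    rewrite Re_sum_real -sumEFin; apply: eq_bigr => p _.
    have [hp _] := hint _ (l_gt0 p).
    rewrite -RintegralZl // /Rintegral fineK //.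
    exact: (integrable_fin_num mT (gint p)).
  rewrite -[leLHS]gee0_abs; last by rewrite lee_fin -lecR modulusE normr_ge0.
  rewrite fAE (le_trans (le_abse_integral _ mT _)) //.
    exact: measurable_int gsint.
  apply: ae_ge0_le_integral => //.
  - by apply: measurableT_comp => //; exact: measurable_int gsint.
  - by move=> t _; rewrite mule_ge0 ?lee_fin.
  (* Where the transform equals [h t], the sum of the [g p t] is [h t] times the real part of [u]
     times the product of the two exponential entries; since [u] has modulus 1, that real part is at
     most [w t] in absolute value. *)
  apply: (@filterS _ _ F _ _ _ Lh) => t /= Lt t0.
  rewrite Lt // sumEFin -EFinM lee_fin wE.
  have -> : \sum_p g p t
      = complex.Re (u * \sum_p c p * (expR (- (l p * t)))%:C) * h t.
    rewrite mulr_sumr; under [in RHS]eq_bigr do rewrite mulrA.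
    rewrite Re_sum_real mulr_suml; apply: eq_bigr => p _.
    by rewrite /g mulrA.
  rewrite normrM ler_wpM2r // (le_trans (ler_Re_modulus _)) //.
  by rewrite modulusM modu mul1r.
split=> // gamma0; apply: (le_trans bound).
rewrite le_eqVlt; apply/orP; left; apply/eqP.
apply: ae_eq_integral => //.
apply: (@filterS _ _ F _ _ _ (L0 gamma0)) => t /= Lt t0.
by rewrite Lt.
Qed.
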